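(* Let $n\ge 1$ and let $\alpha=(\alpha_1,\ldots,\alpha_p)$ and $\beta=(\beta_1,\ldots,\beta_q)$ be two partitions of $n$, with $p$ and $q$ parts respectively. Let $d=\gcd(\alpha_1,\ldots,\alpha_p,\beta_1,\ldots,\beta_q)$. Then a weighted tree with passport $(\alpha,\beta)$ exists if and only if $$p+q\le \frac{n}{d}+1.$$
   Context: A weighted tree is a finite bicolored plane tree whose edges carry positive integer weights. Bicolored means that every vertex is black or white and every edge joins a black vertex to a white vertex. Plane means that the tree is embedded in the sphere, i.e. a cyclic order of the edges around each vertex is fixed. The degree of a vertex is the sum of the weights of the edges incident to it. The total weight $n$ is the sum of all edge weights. The passport of a weighted tree of total weight $n$ is the pair $(\alpha,\beta)$ of partitions of $n$ formed by the degrees of the black vertices and the degrees of the white vertices, respectively. *)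

(* Defs.v *)
From mathcomp Require Import all_boot all_fingroup.

Set Implicit Arguments.
Unset Strict Implicit.
Unset Printing Implicit Defensive.

Section BicoloredGraph.

Variables (B W E : finType) (bend : E -> B) (wend : E -> W).

Definition adj (x y : B + W) : bool :=
  match x, y with
  | inl b, inr w | inr w, inl b => [exists e, (bend e == b) && (wend e == w)]
  | _, _ => false
  end.

(* The first clause forbids parallel edges, i.e. cycles of length 2, which
   [adj] cannot see; the last one forbids the longer cycles. *)
Definition is_tree : Prop :=
  [/\ injective (fun e => (bend e, wend e)),
      0 < #|{: B + W}|,
      forall x y : B + W, connect adj x y
    & forall c : seq (B + W), path.cycle adj c -> uniq c -> size c <= 2].

End BicoloredGraph.

(* The plane structure is a rotation system: [brot] (resp. [wrot]) sends an
   edge to the next one around its black (resp. white) end, so its cycles are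
   exactly the sets of edges incident to a given vertex.  Every rotation system
   on a tree is spherical, so no genus condition is needed. *)
Record weighted_tree := WeightedTree {
  black : finType;
  white : finType;
  edge : finType;
  bend : edge -> black;
  wend : edge -> white;
  brot : {perm edge};
  wrot : {perm edge};
  weight : edge -> nat;
  treeP : is_tree bend wend;
  brotP : forall e f, (f \in porbit brot e) = (bend f == bend e);
  wrotP : forall e f, (f \in porbit wrot e) = (wend f == wend e);
  weight_gt0 : forall e, 0 < weight e
}.

Definition bdegree (t : weighted_tree) (b : black t) : nat :=
  \sum_(e | bend e == b) weight e.

Definition wdegree (t : weighted_tree) (w : white t) : nat :=
  \sum_(e | wend e == w) weight e.

Definition is_partition (n : nat) (s : seq nat) : bool :=
  [&& sorted geq s, all (ltn 0) s & sumn s == n].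

Definition passport (t : weighted_tree) : seq nat * seq nat :=
  (sort geq [seq bdegree b | b : black t],
   sort geq [seq wdegree w | w : white t]).

(* Main.v *)
Require Import Defs.
From mathcomp Require Import all_boot all_fingroup.

(** Necessity: cutting an edge splits the tree in two, and the weight of that
    edge is the difference of the black and white degree sums on one side.
    Hence [d] divides all [p + q - 1] weights, whose sum is [n].

    Sufficiency: weighted bicolored graphs with given degrees are the
    nonnegative integer matrices with given row and column sums.  A greedy
    choice yields one whose support is a forest.  If two edges of distinct
    weights lie in different components, a local modification merges these
    components and keeps the degrees.  When no such modification is possible
    and the forest is still disconnected, all its weights are equal to some [k];
    then [k] divides [d], and [n / d <= n / k], which is at most [p + q - 2]. *)

Set Implicit Arguments.
Unset Strict Implicit.
Unset Printing Implicit Defensive.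

(** * Counting components, and permutations with prescribed cycles *)

Lemma n_comp_gt0 (T : finType) (e : rel T) (x : T) :
  connect_sym e -> 0 < n_comp e T.
Proof.
move=> syme; apply/card_gt0P; exists (root e x).
by rewrite inE /= andbT roots_root.
Qed.

(** Sending each root of [e] to its root for [e'] is onto the roots of [e'], and it is not
    injective: the roots of [x] and [y] have the same image. *)
Lemma n_comp_lt (T : finType) (e e' : rel T) (x y : T) :
    connect_sym e -> connect_sym e' -> subrel e (connect e') ->
    ~~ connect e x y -> connect e' x y ->
  n_comp e' T < n_comp e T.
Proof.
move=> syme syme' /connect_sub ee' nexy e'xy; pose f := root e'.
have fE u v : connect e u v -> f u = f v by move=> /ee'/(rootP syme').
have cardE (g : rel T) : n_comp g T = #|[set z | roots g z]|.
  by rewrite /n_comp_mem cardsE; apply: eq_card => z; rewrite !inE andbT.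
rewrite !cardE -(_ : f @: [set z | roots e z] = [set z | roots e' z]).
  rewrite ltn_neqAle leq_imset_card andbT; apply/imset_injP => f_inj.
  case/negP: nexy; rewrite -(root_connect syme); apply/eqP/f_inj.
  - by rewrite inE roots_root.
  - by rewrite inE roots_root.
  rewrite -(fE _ _ (connect_root e x)) -(fE _ _ (connect_root e y)).
  exact/(rootP syme').
apply/setP => z; rewrite inE; apply/imsetP/idP => [[u _ ->]|/eqP rz].
  exact: (roots_root syme').
exists (root e z); first by rewrite inE roots_root.
by rewrite -(fE _ _ (connect_root e z)) /f rz.
Qed.

Lemma connect_isolated (T : finType) (e : rel T) (x y : T) :
  (forall z, ~~ e x z) -> connect e x y -> x = y.
Proof.
by move=> ne /connectP[[|z p] /= + ->//]; rewrite (negbTE (ne z)).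
Qed.

(** The permutation sends each element to the next one in the enumeration of its fiber. Applied to
    the end maps of a graph, it supplies a rotation system. *)
Lemma perm_of_fibers (T : finType) (S : eqType) (f : T -> S) :
  exists s : {perm T}, forall x y, (y \in porbit s x) = (f y == f x).
Proof.
pose fib x := enum [pred y | f y == f x]; pose g x := next (fib x) x.
have mem_fib x y : (y \in fib x) = (f y == f x) by rewrite mem_enum inE.
have fib_eq x y : f x = f y -> fib x = fib y by rewrite /fib => ->.
have uniq_fib x : uniq (fib x) by apply: enum_uniq.
have fg x : f (g x) = f x by apply/eqP; rewrite -mem_fib mem_next mem_fib.
have g_inj : injective g.
  move=> x y gxy; have fxy : f x = f y by rewrite -fg gxy fg.
  rewrite -(prev_next (uniq_fib x) x) -/(g x) gxy /g (fib_eq x y) //.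
  by rewrite prev_next.
exists (perm g_inj) => x y; rewrite -mem_fib.
have cyc : fcycle g (fib x).
  have := cycle_next (uniq_fib x).
  apply: (sub_in_cycle (P := [pred z | f z == f x])); last first.
    by apply/allP => z; rewrite mem_fib.
  by move=> u v /eqP fu _; rewrite /= /g (fib_eq _ _ fu).
rewrite -(fconnect_cycle cyc (_ : x \in _)) ?mem_fib //.
have itE i : (perm g_inj ^+ i)%g x = iter i g x.
  by rewrite permX; apply: eq_iter => z; rewrite permE.
apply/porbitP/idP => [[i ->]|/iter_findex <-].
  by rewrite itE fconnect_iter.
by exists (findex g x y); rewrite itE.
Qed.

(** * Edge count of connected bicolored graphs *)

Section BicoloredGraphs.
Variables (B W E : finType) (bend : E -> B) (wend : E -> W).
Local Notation adj := (adj bend wend).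

Lemma adj_sym : symmetric adj.
Proof. by move=> [b|w] [b'|w']. Qed.

Lemma adj_connect_sym : connect_sym adj.
Proof. exact: sym_connect_sym adj_sym. Qed.

Lemma adj_edge e : adj (inl (bend e)) (inr (wend e)).
Proof. by apply/existsP; exists e; rewrite !eqxx. Qed.

Lemma adjP x y : reflect
  (exists e, (x = inl (bend e) /\ y = inr (wend e)) \/
             (x = inr (wend e) /\ y = inl (bend e))) (adj x y).
Proof.
apply: (iffP idP) => [|[e [[-> ->]|[-> ->]]]]; last 2 first.
- exact: adj_edge.
- by rewrite adj_sym adj_edge.
case: x y => [b|w] [b'|w'] //= /existsP[e /andP[/eqP<- /eqP<-]]; exists e; by auto.
Qed.

(** A vertex set is grown from [r] one vertex at a time; each new vertex brings at least one new
    edge with both ends in the set. *)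
Lemma connected_card_le :
  (forall x y, connect adj x y) -> #|{: B + W}| <= #|E|.+1.
Proof.
move=> conn; have [r _|B0] := pickP {: B + W}; last by rewrite eq_card0.
pose inner (S : {set B + W}) :=
  [set e | (inl (bend e) \in S) && (inr (wend e) \in S)].
suff H k : k < #|{: B + W}| ->
    exists2 S : {set B + W}, r \in S /\ #|S| = k.+1 & k <= #|inner S|.
  case: #|_| H => // k /(_ k (leqnn _))[S _ /leq_trans]; apply.
  by apply: max_card.
elim: k => [|k IHk] ltk; first by exists [set r]; rewrite ?set11 ?cards1.
have [S [rS cS] leS] := IHk (ltnW ltk).
have [x [y [xS yS /adjP[e xye]]]] :
    exists x, exists y, [/\ x \in S, y \notin S & adj x y].
  case: (pickP [pred z : (B + W) * (B + W) |
           [&& z.1 \in S, z.2 \notin S & adj z.1 z.2]]) => [[x y] /= /and3P[]|no].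
    by exists x, y.
  (* If no edge left [S], then [S] would be closed under adjacency, hence contain every vertex by
     connectedness, against its size. *)
  have clS : closed adj S.
    apply: (intro_closed _ (a := mem S)) => [|x y axy xS]; first exact: adj_connect_sym.
    by have := no (x, y); rewrite /= xS axy andbT /= => /negbFE.
  have: #|S| = #|{: B + W}|.
    by apply: eq_card => z; rewrite -(closed_connect clS (conn r z)) rS.
  by move=> H; rewrite -H cS ltnn in ltk.
exists (y |: S); first by rewrite setU1r // cardsU1 yS cS.
apply: leq_ltn_trans leS _; apply: proper_card; apply/properP; split.
  by apply/subsetP => f; rewrite !inE => /andP[-> ->]; rewrite !orbT.
exists e; rewrite !inE; move: xS yS;
  by case: xye => -[-> ->] xS yS; rewrite ?xS ?(negbTE yS) ?eqxx ?orbT ?andbF.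
Qed.

End BicoloredGraphs.

(** * Bridges and cycles *)

Section EdgeDeletion.
Variables (B W E : finType) (bend : E -> B) (wend : E -> W).
Local Notation adj := (adj bend wend).

(** Taking the remaining edges as a subtype makes this an instance of [adj], so that the results on
    bicolored graphs apply to it. *)
Definition adj_del (e0 : E) : rel (B + W) :=
  Defs.adj (fun e : {e | e != e0} => bend (val e))
           (fun e : {e | e != e0} => wend (val e)).

Lemma adj_delP e0 x y : reflect
  (exists2 e, e != e0 & (x = inl (bend e) /\ y = inr (wend e)) \/
             (x = inr (wend e) /\ y = inl (bend e))) (adj_del e0 x y).
Proof.
apply: (iffP (adjP _ _ _ _)) => [[[e ne] /= H]|[e ne H]]; first by exists e.
by exists (Sub e ne).
Qed.

Lemma sub_adj_del e0 : subrel (adj_del e0) adj.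
Proof. by move=> x y /adj_delP[e _ H]; apply/adjP; exists e. Qed.

(** A simple path that avoids [e0] and joins its ends closes up into a cycle of [adj]. Acyclicity
    leaves only a path of length one, that is, an edge parallel to [e0]. *)
Lemma tree_bridge e0 : is_tree bend wend ->
  ~~ connect (adj_del e0) (inl (bend e0)) (inr (wend e0)).
Proof.
case=> inj _ _ acyc; apply/negP => /connectP[p0 /shortenP[p pth uniqp _] lastp].
have := acyc (inl (bend e0) :: p); rewrite /= rcons_path -lastp adj_sym adj_edge andbT.
rewrite (sub_path (@sub_adj_del e0)) // => /(_ isT uniqp).
case: p lastp pth {uniqp} => [|x [|//]] //= <-; rewrite andbT => + _.
case/existsP => -[e ne] /= /andP[/eqP eb /eqP ew].
by case/eqP: ne; apply: inj; rewrite eb ew.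
Qed.

(** [e0] joins the first two vertices [x] and [y]; the rest of the cycle still leads from [y] back
    to [x]. *)
Lemma cycle_nonbridge c : path.cycle adj c -> uniq c -> 2 < size c ->
  exists e0, connect (adj_del e0) (inl (bend e0)) (inr (wend e0)).
Proof.
case: c => [|x [|y [|z c]]] //=; rewrite rcons_path.
move=> /and3P[/adjP[e0 xy] yz /andP[zc cx]] /and3P[xN yN zN] _; exists e0.
have sym := @adj_connect_sym _ _ _ (fun e : {e | e != e0} => bend (val e))
           (fun e : {e | e != e0} => wend (val e)).
suff: connect (adj_del e0) y x.
  by case: xy => -[-> ->] //; rewrite /adj_del sym.
have := xN; rewrite !inE !negb_or => /and3P[_ nxz _].
have := yN; rewrite inE negb_or => /andP[nyz _].
(* The ends of [e0] are [x] and [y], so an edge with an end elsewhere survives the deletion. *)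
have del u v : adj u v ->
    ([/\ u != x & u != y] \/ [/\ v != x & v != y]) -> adj_del e0 u v.
  move=> /adjP[e uv] H; apply/adj_delP; exists e => //.
  apply/eqP => ee0; rewrite ee0 in uv.
  by case: xy uv H => -[-> ->] [] [-> ->] [] []; rewrite ?eqxx.
apply: (@connect_trans _ _ z).
  by apply/connect1/del => //; right; rewrite eq_sym nxz eq_sym nyz.
have avoid : all [pred u | (u != x) && (u != y)] (z :: c).
  apply/allP => u uzc /=; apply/andP; split.
    by apply: contraNneq xN => <-; rewrite !inE in uzc *; rewrite uzc orbT.
  by apply: contraNneq yN => <-.
have delz : {in [pred u | (u != x) && (u != y)] &, subrel adj (adj_del e0)}.
  by move=> u v /andP[ux uy] _ uv; apply: del => //; left.
apply: (@connect_trans _ _ (last z c)).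
  by apply/connectP; exists c; rewrite ?(sub_in_path delz).
apply/connect1/del => //; left; apply/andP.
exact: (allP avoid _ (mem_last z c)).
Qed.
End EdgeDeletion.

(** * Necessity of the bound *)

Section DegreeDivisors.
Variable t : weighted_tree.

Lemma sum_bdegree : \sum_b @bdegree t b = \sum_e @weight t e.
Proof. by rewrite (partition_big (@bend t) predT). Qed.

Lemma dvdn_weight d (e : edge t) :
    (forall b, d %| @bdegree t b) -> (forall w, d %| @wdegree t w) ->
  d %| weight e.
Proof.
move=> db dw; have := tree_bridge e (treeP t).
set R := adj_del _ _ e => sep.
have symR : connect_sym R by exact: adj_connect_sym.
(* Only [e] leaves [S], from a black vertex: the black degrees in [S] exceed the
   white ones by the weight of [e]. *)
pose S := connect R (inl (bend e)).
have same f : f != e -> S (inl (bend f)) = S (inr (wend f)).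
  move=> ne; apply: (same_connect_r symR); apply/connect1/adj_delP.
  by exists f; auto.
have bE : \sum_(b | S (inl b)) @bdegree t b = \sum_(f | S (inl (bend f))) weight f.
  rewrite (partition_big (@bend t) (fun b => S (inl b))) //=.
  by apply: eq_bigr => b Sb; apply: eq_bigl => f; case: eqP => [->|]; rewrite ?Sb ?andbF.
have wE : \sum_(w | S (inr w)) @wdegree t w = \sum_(f | S (inr (wend f))) weight f.
  rewrite (partition_big (@wend t) (fun w => S (inr w))) //=.
  by apply: eq_bigr => w Sw; apply: eq_bigl => f; case: eqP => [->|]; rewrite ?Sw ?andbF.
have : d %| \sum_(f | S (inl (bend f))) weight f by rewrite -bE; apply: dvdn_sum.
rewrite (bigD1 e) /=; last exact: connect0.
rewrite (eq_bigl (fun f => S (inr (wend f)))); last first.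
  move=> f; have [->|ne] := eqVneq f e; last by rewrite andbT same.
  by rewrite andbF /S (negbTE sep).
by rewrite -wE dvdn_addl //; apply: dvdn_sum.
Qed.

(** Each edge weighs at least [d], so there are at most [n / d] edges, and connectedness bounds the
    vertices by one more. *)
Lemma leq_card_vertices d : 0 < d ->
    (forall b, d %| @bdegree t b) -> (forall w, d %| @wdegree t w) ->
  #|black t| + #|white t| <= (\sum_b @bdegree t b) %/ d + 1.
Proof.
move=> d0 db dw; have [_ _ conn _] := treeP t.
rewrite -card_sum addn1; apply: leq_trans (connected_card_le conn) _.
rewrite ltnS leq_divRL // sum_bdegree -sum_nat_const.
by apply: leq_sum => e _; rewrite dvdn_leq ?weight_gt0 ?dvdn_weight.
Qed.
End DegreeDivisors.

(** * Matrices with given margins and forest support *)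

Section TransportMatrices.
Variables B W : finType.
Implicit Types m : {ffun B * W -> nat}.

Definition supp m := [set x | 0 < m x].

Definition madj m (x y : B + W) : bool :=
  match x, y with
  | inl b, inr w | inr w, inl b => 0 < m (b, w)
  | _, _ => false
  end.

Definition has_margins (a : B -> nat) (b : W -> nat) m :=
  (forall i, \sum_j m (i, j) = a i) /\ (forall j, \sum_i m (i, j) = b j).

(* The reverse inequality holds for every bipartite graph. *)
Definition is_forest m := #|supp m| + n_comp (madj m) {: B + W} <= #|{: B + W}|.

Lemma madj_connect_sym m : connect_sym (madj m).
Proof. by apply: sym_connect_sym => -[b|w] [b'|w']. Qed.

(** Greedy filling, by induction on the total: the smaller of two positive margins is placed in cell
    [(i, j)] and the remaining margins are filled recursively. *)
Lemma forest_exists (a : B -> nat) (b : W -> nat) :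
  \sum_i a i = \sum_j b j -> exists2 m, has_margins a b m & is_forest m.
Proof.
have [N] := ubnP (\sum_i a i); elim: N a b => // N IHN a b leN sumE.
have [i i_gt0|a0] := pickP (fun i => 0 < a i); last first.
  have a0' i : a i = 0 by have := a0 i; case: (a i).
  have b0 j : b j = 0.
    apply/eqP; rewrite -leqn0 -(_ : \sum_i a i = 0); last exact: big1.
    by rewrite sumE (bigD1 j) //= leq_addr.
  exists [ffun => 0].
    by split=> k; rewrite big1 // => ? _; rewrite ffunE.
  rewrite /is_forest (_ : supp _ = set0) ?cards0 ?add0n; first exact: max_card.
  by apply/setP => x; rewrite !inE ffunE.
have [j j_gt0|b0] := pickP (fun j => 0 < b j); last first.
  suff : a i <= 0 by rewrite leqNgt i_gt0.
  rewrite -(_ : \sum_j b j = 0); first by rewrite -sumE (bigD1 i) //= leq_addr.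
  by rewrite big1 // => j _; have := b0 j; case: (b j).
pose s := minn (a i) (b j).
have s_gt0 : 0 < s by rewrite leq_min i_gt0.
pose a' k := a k - s * (k == i); pose b' k := b k - s * (k == j).
have aE k : a' k + s * (k == i) = a k.
  by rewrite subnK //; case: eqP => [->|]; rewrite ?muln0 ?muln1 ?geq_minl.
have bE k : b' k + s * (k == j) = b k.
  by rewrite subnK //; case: eqP => [->|]; rewrite ?muln0 ?muln1 ?geq_minr.
have delta (I : finType) (k : I) : \sum_l s * (l == k) = s.
  rewrite (bigD1 k) //= eqxx muln1 big1 ?addn0 // => l /negbTE->.
  by rewrite muln0.
have saE : \sum_k a k = \sum_k a' k + s.
  by rewrite -(delta _ i) -big_split /=; apply: eq_bigr => k _; rewrite aE.
have sbE : \sum_k b k = \sum_k b' k + s.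
  by rewrite -(delta _ j) -big_split /=; apply: eq_bigr => k _; rewrite bE.
have [||m [rowm colm] Fm] := IHN a' b'.
- by rewrite -ltnS (leq_trans _ leN) // ltnS saE -addn1 leq_add2l.
- by apply/eqP; rewrite -(eqn_add2r s) -saE -sbE sumE.
pose m' := [ffun x => m x + s * (x == (i, j))].
(* Taking the minimum exhausts row [i] or column [j], so one of these two vertices is isolated in
   [m]. *)
have m0 : (a' i == 0) || (b' j == 0).
  rewrite /a' /b' !eqxx !muln1 !subn_eq0 /s.
  by case: (leqP (a i) (b j)); rewrite leqnn ?orbT.
have colz j0 k : b' j0 == 0 -> m (k, j0) = 0.
  by rewrite -colm sum_nat_eq0 => /forall_inP/(_ k isT)/eqP.
have rowz i0 k : a' i0 == 0 -> m (i0, k) = 0.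
  by rewrite -rowm sum_nat_eq0 => /forall_inP/(_ k isT)/eqP.
exists m'.
  split=> k.
    rewrite -aE -rowm -(delta _ j) -mulnC big_distrr -big_split /=.
    apply: eq_bigr => l _; rewrite ffunE xpair_eqE.
    by case: eqP; rewrite ?mul1n ?mul0n ?andbF ?muln0.
  rewrite -bE -colm -(delta _ i) -mulnC big_distrr -big_split /=.
  apply: eq_bigr => l _; rewrite ffunE xpair_eqE andbC.
  by case: eqP; rewrite ?mul1n ?mul0n ?andbF ?muln0.
(* The new cell ties that isolated vertex to another component: at most one more edge, at least one
   component fewer. *)
have lt_comp : n_comp (madj m') {: B + W} < n_comp (madj m) {: B + W}.
  apply: (@n_comp_lt _ _ _ (inl i) (inr j)); try exact: madj_connect_sym.
  - by move=> [k|k] [l|l] //= mkl; apply: connect1; rewrite /= ffunE ltn_addr.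
  - case/orP: m0 => z; [|rewrite madj_connect_sym]; apply/negP => /connect_isolated H.
      suff: inl i = inr j :> B + W by [].
      by apply: H => -[k|k] //=; rewrite rowz.
    suff: inr j = inl i :> B + W by [].
    by apply: H => -[k|k] //=; rewrite colz.
  by apply: connect1; rewrite /= ffunE eqxx muln1 ltn_addl.
have le_supp : #|supp m'| <= #|supp m|.+1.
  apply: (@leq_trans #|(i, j) |: supp m|); last by rewrite cardsU1; case: (_ \in _).
  apply/subset_leq_card/subsetP => x; rewrite !inE ffunE.
  by case: eqP => //= _; rewrite muln0 addn0.
by apply: leq_trans Fm; have := leq_add le_supp lt_comp; rewrite addSn addnS.
Qed.

(* The edges [b1 w1] and [b2 w2], of weights [s < t], are replaced by [b1 w2],
   [b2 w1] and [b2 w2], of weights [s], [s] and [t - s]. *)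
Lemma forest_merge a b m b1 w1 b2 w2 :
    has_margins a b m -> is_forest m ->
    0 < m (b1, w1) -> m (b1, w1) < m (b2, w2) ->
    ~~ connect (madj m) (inl b1) (inl b2) ->
  exists m', [/\ has_margins a b m', is_forest m' &
    n_comp (madj m') {: B + W} < n_comp (madj m) {: B + W}].
Proof.
set s := m (b1, w1) => -[rowm colm] Fm s_gt0 lt_st sep.
have symm := @madj_connect_sym m.
have m22 : 0 < m (b2, w2) by apply: ltn_trans lt_st.
have c11 : connect (madj m) (inl b1) (inr w1) by apply: connect1.
have c22 : connect (madj m) (inr w2) (inl b2) by apply: connect1.
have b12 : b1 != b2 by apply: contraNneq sep => ->; apply: connect0.
have w12 : w1 != w2.
  by apply: contraNneq sep => w12; apply: connect_trans c11 _; rewrite w12.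
pose add (x : B * W) := (x == (b1, w2)) + (x == (b2, w1)).
pose sub (x : B * W) := (x == (b1, w1)) + (x == (b2, w2)).
pose m' := [ffun x => m x + s * add x - s * sub x].
(* The truncated subtraction is exact, since both cells of [sub] hold at least [s]; the additive
   form is the one used below. *)
have m'E x : m' x + s * sub x = m x + s * add x.
  rewrite ffunE subnK // /sub; apply: leq_trans (leq_addr _ _).
  have [->|_] := eqVneq x (b1, w1).
    by rewrite xpair_eqE (negbTE b12) muln1.
  by have [->|_] := eqVneq x (b2, w2); rewrite ?muln0 // muln1 ltnW.
have delta (I : finType) (k : I) : \sum_l (l == k) = 1.
  by rewrite (bigD1 k) //= eqxx big1 ?addn0 // => l /negbTE->.
have delta_row (i b0 : B) (w0 : W) : \sum_j ((i, j) == (b0, w0)) = (i == b0).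
  under eq_bigr do rewrite xpair_eqE -mulnb.
  by rewrite -big_distrr /= delta muln1.
have delta_col (j : W) (b0 : B) (w0 : W) : \sum_i ((i, j) == (b0, w0)) = (j == w0).
  under eq_bigr do rewrite xpair_eqE -mulnb.
  by rewrite -big_distrl /= delta mul1n.
exists m'; have Hm' : has_margins a b m'.
  split=> k.
    apply/eqP; rewrite -(eqn_add2r (s * ((k == b1) + (k == b2)))) -{1}rowm.
    rewrite -{1}(delta_row k b1 w1) -{1}(delta_row k b2 w2).
    rewrite -(delta_row k b1 w2) -(delta_row k b2 w1).
    rewrite -!big_split /= !big_distrr /= -!big_split /=.
    by apply/eqP/eq_bigr => j _; apply: m'E.
  apply/eqP; rewrite -(eqn_add2r (s * ((k == w1) + (k == w2)))) -{1}colm.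
  rewrite -{1}(delta_col k b1 w1) -{1}(delta_col k b2 w2).
  rewrite -(delta_col k b1 w2) -(delta_col k b2 w1).
  rewrite -!big_split /= !big_distrr /= -!big_split /=.
  apply/eqP/eq_bigr => j _; rewrite [X in _ = _ + s * X]addnC; exact: m'E.
(* At [(b2, w2)] positivity rests on the strict inequality between the two weights. *)
have keep x : x != (b1, w1) -> 0 < m x -> 0 < m' x.
  move=> x1 mx; rewrite -(ltn_add2r (s * sub x)) m'E add0n /sub (negbTE x1).
  apply: leq_trans (leq_addr _ _).
  by have [->|_] := eqVneq x (b2, w2); rewrite ?muln0 // muln1.
have new x : 0 < add x -> 0 < m' x.
  move=> ax; rewrite -(ltn_add2r (s * sub x)) m'E add0n.
  have -> : sub x = 0.
    move: ax; rewrite /add /sub.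
    have [->|_] := eqVneq x (b1, w2).
      by rewrite !xpair_eqE !eqxx [w2 == w1]eq_sym (negbTE w12) (negbTE b12).
    have [->|//] := eqVneq x (b2, w1).
    by rewrite !xpair_eqE !eqxx [b2 == b1]eq_sym (negbTE w12) (negbTE b12).
  by rewrite muln0 ltn_addl // muln_gt0 s_gt0.
have m'12 : 0 < m' (b1, w2) by apply: new; rewrite /add eqxx.
have m'21 : 0 < m' (b2, w1) by apply: new; rewrite /add eqxx addn1.
have m'22 : 0 < m' (b2, w2).
  by apply: keep; rewrite // xpair_eqE eq_sym (negbTE b12).
have symm' := @madj_connect_sym m'.
have c12' : connect (madj m') (inl b1) (inl b2).
  by apply: (@connect_trans _ _ (inr w2)); apply: connect1.
(* The path [b1 w2 b2 w1] stands in for the deleted edge [b1 w1]. *)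
have c11' : connect (madj m') (inl b1) (inr w1).
  by apply: connect_trans c12' _; apply: connect1.
have lt_comp : n_comp (madj m') {: B + W} < n_comp (madj m) {: B + W}.
  apply: (@n_comp_lt _ _ _ (inl b1) (inl b2)) => // -[i|j] [k|l] //= mx.
    have [[-> ->]//|ne] := eqVneq (i, l) (b1, w1).
    by apply: connect1; apply: keep.
  have [[-> ->]|ne] := eqVneq (k, j) (b1, w1); first by rewrite symm'.
  by apply: connect1; apply: keep.
have m'11 : m' (b1, w1) = 0.
  rewrite ffunE /add /sub !xpair_eqE !eqxx (negbTE b12) (negbTE w12) /=.
  by rewrite muln0 addn0 muln1 subnn.
suff le_supp : #|supp m'| <= #|supp m|.+1.
  split=> //; apply: leq_trans Fm.
  by have := leq_add le_supp lt_comp; rewrite addSn addnS.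
(* The support gains at most two cells and loses [(b1, w1)]. *)
apply: (@leq_trans #|[set (b1, w2); (b2, w1)] :|: supp m :\ (b1, w1)|).
  apply/subset_leq_card/subsetP => x; rewrite !inE => m'x.
  have := m'E x; rewrite /add.
  have [//|_] := eqVneq x (b1, w2); have [//|_] := eqVneq x (b2, w1).
  rewrite /= muln0 addn0 => <-; rewrite ltn_addr // andbT.
  by apply: contraTneq m'x => ->; rewrite m'11.
rewrite (leq_trans (leq_card_setU _ _)) // cards2 [(b1, w2) == _]xpair_eqE.
rewrite (negbTE b12) /= (cardsD1 (b1, w1) (supp m)) inE.
by rewrite (_ : 0 < m (b1, w1)).
Qed.

(** Induction on the number of components of a forest matrix, merging as long as two components
    contain edges of different weights. *)
Lemma tree_matrix_exists a b :
    0 < #|{: B + W}| -> (forall i, 0 < a i) -> (forall j, 0 < b j) ->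
    \sum_i a i = \sum_j b j ->
    (forall k, 0 < k -> (forall i, k %| a i) -> (forall j, k %| b j) ->
       #|{: B + W}| <= (\sum_i a i) %/ k + 1) ->
  exists m, [/\ has_margins a b m, #|supp m| < #|{: B + W}|
              & forall x y, connect (madj m) x y].
Proof.
move=> V_gt0 a_gt0 b_gt0 sumE gcd_bound; have [m] := forest_exists sumE.
have [N] := ubnP (n_comp (madj m) {: B + W}).
elim: N m => // N IHN m ltN Hm Fm; have [rowm colm] := Hm.
have symm := @madj_connect_sym m.
case: (pickP [pred z : (B + W) * (B + W) | ~~ connect (madj m) z.1 z.2]) => [[x y] /= nxy|conn].
  (* Positive margins exclude isolated vertices, so every component contains an edge. *)
  have inc z : exists2 e, 0 < m e & connect (madj m) z (inl e.1).
    case: z => [i|j].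
      have: 0 < \sum_j m (i, j) by rewrite rowm.
      rewrite lt0n sum_nat_eq0 negb_forall => /existsP[j]; rewrite -lt0n => mij.
      by exists (i, j); rewrite ?connect0.
    have: 0 < \sum_i m (i, j) by rewrite colm.
    rewrite lt0n sum_nat_eq0 negb_forall => /existsP[i]; rewrite -lt0n => mij.
    by exists (i, j) => //; apply: connect1.
  have [u mu xu] := inc x; have [v mv yv] := inc y.
  case: (pickP [pred z : (B * W) * (B * W) | [&& 0 < m z.1, m z.1 < m z.2 &
      ~~ connect (madj m) (inl z.1.1) (inl z.2.1)]]) => [[[b1 w1] [b2 w2]] /= /and3P[]|const].
    move=> m1 m12 sep; have [m' [Hm' Fm' lt_comp]] := forest_merge Hm Fm m1 m12 sep.
    by apply: (IHN m') => //; apply: leq_trans lt_comp _.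
  have {}const e f : 0 < m e -> 0 < m f ->
      ~~ connect (madj m) (inl e.1) (inl f.1) -> m e = m f.
    move=> me mf sep; have := const (e, f); have := const (f, e).
    by rewrite /= me mf sep symm sep /= !andbT; case: ltngtP.
  have uv : m u = m v.
    apply: const => //; apply: contra nxy => c.
    by apply: connect_trans xu (connect_trans c _); rewrite symm.
  (* [u] and [v] lie in different components, so [e] is separated from at least one of them. *)
  have all_eq e : 0 < m e -> m e = m u.
    move=> me; have [c|] := boolP (connect (madj m) (inl e.1) (inl u.1)); last exact: const.
    rewrite uv; apply: const => //; apply: contra nxy => c'.
    apply: connect_trans xu _; apply: (@connect_trans _ _ (inl e.1)); first by rewrite symm.
    by apply: connect_trans c' _; rewrite symm.
  have dvd_m e : m u %| m e.
    by have [->//|me] := posnP (m e); rewrite all_eq.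
  have sum_m : \sum_i a i = #|supp m| * m u.
    rewrite -sum_nat_const; under eq_bigr do rewrite -rowm.
    rewrite pair_bigA /= [RHS]big_mkcond /=; apply: eq_bigr => -[i j] _ /=.
    by rewrite inE; case: posnP => // /all_eq.
  (* The common weight [m u] divides all margins, and the total divided by it is the number of
     edges. *)
  have bound : #|{: B + W}| <= #|supp m|.+1.
    rewrite -(mulnK #|supp m| mu) -sum_m -addn1; apply: gcd_bound => // [i|j].
      by rewrite -rowm dvdn_sum.
    by rewrite -colm dvdn_sum.
  (* Two components in a forest leave at most [#|{: B + W}| - 2] edges, against [bound]. *)
  have n_comp_gt1 : 1 < n_comp (madj m) {: B + W}.
    pose full : rel (B + W) := fun _ _ => true.
    have symf : connect_sym full by apply: sym_connect_sym.
    apply: leq_ltn_trans (n_comp_gt0 x symf) _.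
    by apply: (n_comp_lt symm symf _ nxy) => [x' y' _|]; apply: connect1.
  by have := leq_trans Fm bound; rewrite -addn1 leq_add2l leqNgt n_comp_gt1.
exists m; split=> // [|x y]; last by apply/negbFE/(conn (x, y)).
have /card_gt0P[x _] := V_gt0.
by apply: leq_trans Fm; rewrite -addn1 leq_add2l (n_comp_gt0 x).
Qed.
End TransportMatrices.

(** * From matrices to weighted trees *)

(** The positive cells serve as edges, so none are parallel; the cyclic orders around vertices may
    be chosen arbitrarily. *)
Lemma tree_of_matrix (B W : finType) (m : {ffun B * W -> nat}) a b :
    has_margins a b m -> #|supp m| < #|{: B + W}| ->
    (forall x y, connect (madj m) x y) ->
  exists t : weighted_tree,
    passport t = (sort geq [seq a i | i : B], sort geq [seq b j | j : W]).
Proof.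
move=> [rowm colm] few conn; pose E := {x | 0 < m x}.
pose bend (e : E) := (val e).1; pose wend (e : E) := (val e).2.
have cardE : #|{: E}| = #|supp m| by rewrite card_sig; apply: eq_card => x; rewrite !inE.
have adjE : adj bend wend =2 madj m.
  have edgeE i j : [exists e, (bend e == i) && (wend e == j)] = (0 < m (i, j)).
    apply/existsP/idP => [[[[k l] /= mkl] /andP[/eqP<- /eqP<-]] //|mij].
    by exists (exist _ (i, j) mij); rewrite /bend /wend /= !eqxx.
  by case=> [i|j] [k|l] //=; rewrite edgeE.
have conn' x y : connect (adj bend wend) x y by rewrite (eq_connect adjE).
have tree : is_tree bend wend.
  split=> //.
  - move=> e f [eb ew]; apply: val_inj; move: eb ew; rewrite /bend /wend.
    by do 2 case: (val _) => ? ?; move=> /= -> ->.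
  - exact: leq_ltn_trans few.
  move=> c cyc uniqc; rewrite leqNgt; apply/negP => size_c.
  have [e0 nb] := cycle_nonbridge cyc uniqc size_c.
  (* A nonbridge leaves a connected graph with too few edges when deleted. *)
  have : #|{: B + W}| <= #|{: {e | e != e0}}|.+1.
    apply: (connected_card_le (bend := fun e => bend (val e))
                              (wend := fun e => wend (val e))).
    move=> x y; apply: connect_sub (conn' x y) => u v /adjP[e uv].
    have symd := adj_connect_sym (fun e : {e | e != e0} => bend (val e))
                   (fun e : {e | e != e0} => wend (val e)).
    have [ee0|ne] := eqVneq e e0.
      by rewrite ee0 in uv; case: uv => -[-> ->]; last rewrite symd.
    by apply/connect1/adj_delP; exists e.
  have E_gt0 : 0 < #|{: E}| by apply/card_gt0P; exists e0.
  rewrite (_ : #|{: {e : E | e != e0}}| = #|{: E}|.-1) ?prednK //; last first.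
    by rewrite card_sig -(cardC1 e0); apply: eq_card.
  by rewrite leqNgt cardE few.
have [brot brotP] := perm_of_fibers bend; have [wrot wrotP] := perm_of_fibers wend.
exists (@WeightedTree B W E bend wend brot wrot (fun e => m (val e)) tree
          brotP wrotP (fun e => valP e)).
(* Cells outside the support contribute zero, so degrees are row and column sums. *)
have sum_E (P : pred (B * W)) : \sum_(e : E | P (val e)) m (val e) = \sum_(x | P x) m x.
  rewrite -(big_sub_cond [pred x | 0 < m x] P m) [RHS](bigID [pred x | 0 < m x]) /=.
  rewrite [X in _ + X]big1 ?addn0; last by move=> x /andP[_]; case: (m x).
  by apply: eq_bigl => x; rewrite andbC.
congr (sort _ _, sort _ _).
  apply: eq_map => i; rewrite /bdegree /= (sum_E (fun x => x.1 == i)) -rowm.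
  rewrite (reindex_onto (pair i) snd) => [|[k l] /= /eqP-> //].
  by apply: eq_bigl => j; rewrite /= !eqxx.
apply: eq_map => j; rewrite /wdegree /= (sum_E (fun x => x.2 == j)) -colm.
rewrite (reindex_onto (fun i => (i, j)) fst) => [|[k l] /= /eqP-> //].
by apply: eq_bigl => i; rewrite /= !eqxx.
Qed.

(** * The gcd criterion *)

Lemma dvdn_gcd_seq k (s : seq nat) :
  (k %| \big[gcdn/0]_(x <- s) x) = all (dvdn k) s.
Proof.
by elim: s => [|x s IHs]; rewrite ?big_nil ?dvdn0 // big_cons dvdn_gcd IHs.
Qed.

Theorem theorem3p1 (n : nat) (alpha beta : seq nat)
    (n_gt0 : 1 <= n)
    (alphaP : is_partition n alpha) (betaP : is_partition n beta) :
  let d := \big[gcdn/0]_(x <- alpha ++ beta) x in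
  (exists t : weighted_tree, passport t = (alpha, beta)) <->
  size alpha + size beta <= n %/ d + 1.
Proof.
move=> d; case/and3P: alphaP => sort_a a_gt0 /eqP sum_a.
case/and3P: betaP => sort_b b_gt0 /eqP sum_b.
have d_dvd x : x \in alpha ++ beta -> d %| x.
  by have := dvdnn d; rewrite {2}/d dvdn_gcd_seq => /allP; apply.
(* An empty gcd would be 0; here [d] divides the positive number [n]. *)
have d_gt0 : 0 < d.
  apply: dvdn_gt0 n_gt0 _; rewrite -sum_a sumnE big_seq dvdn_sum // => x xa.
  by apply: d_dvd; rewrite mem_cat xa.
split=> [[t [aE bE]]|le_pq].
  have size_a : size alpha = #|black t| by rewrite -aE size_sort size_map -cardE.
  have size_b : size beta = #|white t| by rewrite -bE size_sort size_map -cardE.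
  have <- : \sum_b @bdegree t b = n.
    rewrite -sum_a -aE sumnE (perm_big _ (permEl (perm_sort _ _))) big_image.
    exact: eq_bigl.
  rewrite size_a size_b; apply: leq_card_vertices => // v; apply: d_dvd.
    by rewrite mem_cat -aE mem_sort image_f.
  by rewrite mem_cat -bE mem_sort image_f ?orbT.
pose a := tnth (in_tuple alpha); pose b := tnth (in_tuple beta).
have sumaE : \sum_i a i = n by rewrite -sum_a sumnE (big_tnth _ _ alpha).
have sumbE : \sum_j b j = n by rewrite -sum_b sumnE (big_tnth _ _ beta).
have [|||||m [Hm few conn]] := @tree_matrix_exists _ _ a b.
- rewrite card_sum !card_ord addn_gt0; case: (alpha) sum_a => //= n0.
  by rewrite -n0 in n_gt0.
- by move=> i; apply: (allP a_gt0); apply: mem_tnth.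
- by move=> i; apply: (allP b_gt0); apply: mem_tnth.
- by rewrite sumaE.
(* A common divisor [k] of all parts divides [d], so [n / d <= n / k]. *)
- move=> k k_gt0 ka kb; rewrite card_sum !card_ord sumaE.
  apply: leq_trans le_pq _; rewrite leq_add2r; apply: leq_div2l => //.
  rewrite dvdn_leq // dvdn_gcd_seq all_cat; apply/andP.
  split; apply/(all_tnthP (t := in_tuple _)) => i; [exact: ka|exact: kb].
have [t tE] := tree_of_matrix Hm few conn; exists t; rewrite tE.
(* Partitions are already sorted, so the sorting in [passport] gives back [alpha] and [beta]. *)
have geq_trans : transitive geq by move=> y x z /= yx zy; apply: leq_trans yx.
have aE : [seq a i | i : 'I_(size alpha)] = alpha.
  exact: (map_tnth_enum (in_tuple alpha)).
have bE : [seq b j | j : 'I_(size beta)] = beta.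
  exact: (map_tnth_enum (in_tuple beta)).
by rewrite aE bE !sorted_sort.
Qed.
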